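(* Let $R$ be a transcendental Dedekind domain, and let $\alpha,\beta$ be non-zero elements algebraic over the fraction field of $R$ such that $\alpha/\beta$ is not a root of unity. Assume that $\alpha+\beta\in R$ and $\alpha\beta\in R$, and that the principal ideals $\langle\alpha+\beta\rangle$ and $\langle\alpha\beta\rangle$ of $R$ are coprime ideals which are not both equal to $R$. Define the Lucas sequence $L_n=\frac{\alpha^n-\beta^n}{\alpha-\beta}$, $n\ge1$. Then $(L_n)_{n\ge1}$ is a strong divisibility sequence in $R$: for all positive integers $m,n$, a greatest common divisor $\gcd(L_m,L_n)$ in $R$ and $L_{\gcd(m,n)}$ are associated.
   Context: A Dedekind domain $R$ is called transcendental if it is not a field but contains a field. Two elements of $R$ are associated if one equals the other times a unit of $R$. A greatest common divisor of $a,b\in R$ is a common divisor of $a$ and $b$ that is divisible by every common divisor of $a$ and $b$. A sequence $(a_n)_{n\ge1}$ in $R$ is a strong divisibility sequence if for all positive integers $m,n$, $\gcd(a_m,a_n)$ and $a_d$ are associated, where $d=\gcd(m,n)$. *)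

(* Defs.v *)
From mathcomp Require Import all_boot all_algebra.
From mathcomp Require Import boolp.

Set Implicit Arguments.
Unset Strict Implicit.
Unset Printing Implicit Defensive.

Import GRing.Theory.
Local Open Scope ring_scope.

(* Subsets of R are boolean predicates, as in mathcomp's theory of ideals;
   `[< _ >] decides propositions classically, so every subset is of this form.
   idealr_closed characterizes the proper ideals; arbitrary ideals are the
   submodules of the regular module R^o. *)
Section Ideals.
Variable R : idomainType.

Definition ideal (I : {pred R}) : Prop :=
  GRing.submod_closed (I : {pred R^o}).

Definition span_ideal (s : seq R) : {pred R} :=
  fun x => `[< exists c : 'I_(size s) -> R, x = \sum_i c i * s`_i >].

Definition principal_ideal (a : R) : {pred R} :=
  fun x => `[< exists r : R, x = r * a >].

Definition add_ideal (I J : {pred R}) : {pred R} :=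
  fun x => `[< exists2 u, u \in I & exists2 v, v \in J & x = u + v >].

Definition coprime_ideals (I J : {pred R}) : Prop := add_ideal I J =i predT.

Definition prime_ideal (I : {pred R}) : Prop :=
  idealr_closed I /\ prime_idealr_closed I.

Definition maximal_ideal (I : {pred R}) : Prop :=
  idealr_closed I /\
  forall J : {pred R}, idealr_closed J -> {subset I <= J} -> J =i I.

End Ideals.

Section Dedekind.
Variable R : idomainType.

Definition noetherian : Prop :=
  forall I : {pred R}, ideal I -> exists s : seq R, I =i span_ideal s.

Definition integrally_closed : Prop :=
  forall x : {fraction R},
    integralOver (@tofrac R) x -> exists r : R, x = tofrac r.

Definition dimension_le1 : Prop :=
  forall I : {pred R},
    prime_ideal I -> (exists2 x, x \in I & x != 0) -> maximal_ideal I.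

(* Fields are allowed here. *)
Definition dedekind : Prop :=
  [/\ noetherian, integrally_closed & dimension_le1].

Definition is_field : Prop := forall x : R, x != 0 -> x \is a GRing.unit.

Definition contains_field : Prop :=
  exists K : {pred R}, GRing.subring_closed K /\
    {in K, forall x, x != 0 -> exists2 y, y \in K & x * y = 1}.

Definition transcendental_dedekind : Prop :=
  [/\ dedekind, ~ is_field & contains_field].

End Dedekind.

Section Divisibility.
Variable R : idomainType.

Definition divides (d a : R) : Prop := exists q : R, a = q * d.

Definition associated (a b : R) : Prop :=
  exists2 u : R, u \is a GRing.unit & a = u * b.

Definition is_gcd (g a b : R) : Prop :=
  [/\ divides g a, divides g b &
      forall d : R, divides d a -> divides d b -> divides d g].

(* Gcds need not exist in R, so their existence is part of the property. The
   value a 0 is irrelevant: the sequence is indexed by the positive integers. *)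
Definition strong_divisibility_sequence (a : nat -> R) : Prop :=
  forall m n : nat, (0 < m)%N -> (0 < n)%N ->
    exists2 g : R, is_gcd g (a m) (a n) & associated g (a (gcdn m n)).

End Divisibility.

Definition lucas (E : fieldType) (alpha beta : E) (n : nat) : E :=
  (alpha ^+ n - beta ^+ n) / (alpha - beta).

(* Main.v *)
Require Import Defs.
From mathcomp Require Import all_boot all_algebra.
From mathcomp Require Import boolp ring.

(* With P = alpha + beta and Q = alpha * beta, the sequence satisfies
   L_(n+2) = P L_(n+1) - Q L_n, so it lives in R.  Comaximality of P and Q
   propagates along the recurrence: L_n and Q, and hence L_n and L_(n+1), are
   comaximal.  The addition formula
   L_(m+n+1) = L_(m+1) L_(n+1) - Q L_m L_n then shows that a common divisor of
   L_m and L_(m+n) divides L_n, and Euclid's algorithm on the indices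
   concludes. *)

Set Implicit Arguments.
Unset Strict Implicit.
Unset Printing Implicit Defensive.

Import GRing.Theory.
Local Open Scope ring_scope.

Section Comaximal.
Variable R : idomainType.
Implicit Types a b c d x : R.

Definition comaximal a b := exists u v, u * a + v * b = 1.

Lemma comaximal_sym a b : comaximal a b -> comaximal b a.
Proof. by case=> u [v uv1]; exists v, u; rewrite addrC. Qed.

Lemma comaximalMr a b c : comaximal a b -> comaximal a c -> comaximal a (b * c).
Proof.
move=> [u [v uv1]] [u' [v' uv1']].
(* The coefficients come from expanding the product of the two Bezout identities and collecting the
   terms divisible by [a]. *)
exists (u * u' * a + u * v' * c + v * b * u'), (v * v').
by rewrite -[RHS]mulr1 -{1}uv1 -uv1'; ring.
Qed.

Lemma comaximalDl a b c : comaximal a b -> comaximal a (c * a + b).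
Proof. by case=> u [v uv1]; exists (u - v * c), v; rewrite -uv1; ring. Qed.

Lemma comaximalNr a b : comaximal a b -> comaximal a (- b).
Proof. by case=> u [v uv1]; exists u, (- v); rewrite mulrNN. Qed.

Lemma coprime_principal_comaximal a b :
  coprime_ideals (principal_ideal a) (principal_ideal b) -> comaximal a b.
Proof.
move=> /(_ 1); rewrite inE => /asboolP[_ /asboolP[u ->] [_ /asboolP[v ->]]].
by move=> uv1; exists u, v; rewrite uv1.
Qed.

Lemma divides_mull d a b : divides d b -> divides d (a * b).
Proof. by case=> r ->; exists (a * r); rewrite mulrA. Qed.

Lemma dividesD d a b : divides d a -> divides d b -> divides d (a + b).
Proof. by move=> [r ->] [s ->]; exists (r + s); rewrite mulrDl. Qed.

Lemma Gauss_divides d a b x :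
  comaximal a b -> divides d a -> divides d (b * x) -> divides d x.
Proof.
move=> [u [v uv1]] da dbx.
have -> : x = (u * x) * a + v * (b * x) by rewrite -[LHS]mul1r -uv1; ring.
by apply: dividesD; apply: divides_mull.
Qed.

End Comaximal.

Section LucasSequence.
Variables (R : idomainType) (p q : R).

(** Starting at index 0 with the value 0 lets Euclid's algorithm on the indices end at 0, since
    every element divides [L 0]. *)
Fixpoint lucas_seq (n : nat) : R :=
  if n is n'.+1 then
    if n' is n''.+1 then p * lucas_seq n' - q * lucas_seq n'' else 1
  else 0.
Local Notation L := lucas_seq.

Lemma lucas_seqSS n : L n.+2 = p * L n.+1 - q * L n.
Proof. by []. Qed.

Lemma lucas_seq_add m n : L (m + n).+1 = L m.+1 * L n.+1 - q * L m * L n.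
Proof.
(* The induction step moves one unit from [m] to [n], so [n] stays general. *)
elim: m n => [|m IHm] n; first by rewrite add0n [L 1]/= [L 0]/=; ring.
by rewrite addSnnS IHm !lucas_seqSS; ring.
Qed.

Lemma lucas_seq_dvd d n : (d %| n)%N -> divides (L d) (L n).
Proof.
case/dvdnP=> k ->; case: d => [|d]; first by rewrite muln0; exists 1; rewrite mul1r.
elim: k => [|k IHk]; first by exists 0; rewrite mul0r.
(* The index splits as [d.+1 + k * d.+1]: one product in the addition formula contains [L d.+1], the
   other [L (k * d.+1)]. *)
rewrite mulSn addSn lucas_seq_add.
have -> : L d.+1 * L (k * d.+1).+1 - q * L d * L (k * d.+1)
   = L (k * d.+1).+1 * L d.+1 + - (q * L d) * L (k * d.+1) by ring.
by apply: dividesD; apply: divides_mull => //; exists 1; rewrite mul1r.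
Qed.

Hypothesis pq_comax : comaximal p q.

(** Modulo [q] the recurrence becomes multiplication by [p], so [L n.+1] is congruent to [p ^+ n], a
    unit modulo [q]. *)
Lemma comaximal_lucas_seq_q n : comaximal q (L n.+1).
Proof.
elim: n => [|n IHn]; first by exists 0, 1; rewrite /=; ring.
rewrite lucas_seqSS; have -> : p * L n.+1 - q * L n = - L n * q + p * L n.+1 by ring.
by apply/comaximalDl/comaximalMr => //; apply: comaximal_sym.
Qed.

(** Modulo [L n.+1], the next term is [- (q * L n)], and both factors are comaximal with
    [L n.+1]. *)
Lemma comaximal_lucas_seqS n : comaximal (L n) (L n.+1).
Proof.
elim: n => [|n IHn]; first by exists 0, 1; rewrite /=; ring.
rewrite lucas_seqSS; apply/comaximalDl/comaximalNr/comaximalMr.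
  exact/comaximal_sym/comaximal_lucas_seq_q.
exact: comaximal_sym.
Qed.

Lemma lucas_seq_divides_addl d m n :
  divides d (L m) -> divides d (L (m + n)) -> divides d (L n).
Proof.
case: n => [|n] dm; first by exists 0; rewrite mul0r.
rewrite addnS lucas_seq_add => dmn.
(* As [d] divides [L m], the factor [L m.+1] can be cancelled: it is enough that [d] divides
   [L m.+1 * L n.+1]. *)
apply: (Gauss_divides (comaximal_lucas_seqS m) dm).
have -> : L m.+1 * L n.+1
   = (L m.+1 * L n.+1 - q * L m * L n) + (q * L n) * L m by ring.
by apply: dividesD => //; apply: divides_mull.
Qed.

Lemma lucas_seq_divides_gcdn d m n :
  divides d (L m) -> divides d (L n) -> divides d (L (gcdn m n)).
Proof.
(* Subtractive Euclid: for [0 < m <= n], passing from [(m, n)] to [(m, n - m)] lowers the sum of the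
   indices to [n]. *)
have [k] := ubnP (m + n); elim: k m n => // k IHk m n.
wlog le_mn : m n / (m <= n)%N => [hw|].
  have [le_mn|/ltnW le_nm] := leqP m n; first exact: hw.
  by rewrite addnC gcdnC => ? ? ?; apply: hw.
case: m le_mn => [|m] le_mn mn_k dm dn; first by rewrite gcd0n.
rewrite -(subnKC le_mn) in dn *; rewrite gcdnDl.
apply: IHk => //; last exact: lucas_seq_divides_addl dn.
rewrite subnKC //; rewrite ltnS in mn_k; apply: leq_trans mn_k.
by rewrite addSn !ltnS leq_addl.
Qed.

Lemma lucas_seq_strong_divisibility : strong_divisibility_sequence L.
Proof.
move=> m n _ _; exists (L (gcdn m n)); last first.
  by exists 1; rewrite ?unitr1 ?mul1r.
split=> [||d]; first exact/lucas_seq_dvd/dvdn_gcdl.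
  exact/lucas_seq_dvd/dvdn_gcdr.
exact: lucas_seq_divides_gcdn.
Qed.

End LucasSequence.

Lemma rmorph_lucas_seq (R : idomainType) (E : fieldType)
    (f : {rmorphism R -> E}) (alpha beta : E) (p q : R) (n : nat) :
  alpha != beta -> alpha + beta = f p -> alpha * beta = f q ->
  f (lucas_seq p q n) = lucas alpha beta n.
Proof.
rewrite -subr_eq0 => ab0 abp abq.
(* The recurrence has order two, so the induction carries two consecutive values. *)
suff: f (lucas_seq p q n) = lucas alpha beta n /\
      f (lucas_seq p q n.+1) = lucas alpha beta n.+1 by case.
elim: n => [|n [IHn IHn1]].
  by rewrite /lucas !expr0 !expr1 subrr mul0r divff // rmorph0 rmorph1.
split=> //; rewrite lucas_seqSS rmorphB !rmorphM IHn IHn1 -abp -abq /lucas.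
by rewrite !mulrA -mulrBl !exprS; congr (_ / _); ring.
Qed.

Theorem theorem1p3 (R : idomainType) (E : fieldType)
    (iota : {rmorphism {fraction R} -> E}) (alpha beta : E) (p q : R) :
  transcendental_dedekind R ->
  algebraicOver iota alpha -> algebraicOver iota beta ->
  alpha != 0 -> beta != 0 ->
  (forall n : nat, (0 < n)%N -> ~~ n.-unity_root (alpha / beta)) ->
  alpha + beta = iota (tofrac p) ->
  alpha * beta = iota (tofrac q) ->
  coprime_ideals (principal_ideal p) (principal_ideal q) ->
  ~ (principal_ideal p =i predT /\ principal_ideal q =i predT) ->
  exists2 L : nat -> R,
    (forall n : nat, (0 < n)%N -> iota (tofrac (L n)) = lucas alpha beta n) &
    strong_divisibility_sequence L.
Proof.
move=> _ _ _ _ b0 not_root abp abq /coprime_principal_comaximal pq1 _.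
exists (lucas_seq p q); last exact: lucas_seq_strong_divisibility.
(* If [alpha = beta], the quotient would be 1, a root of unity of order 1. Hence the denominator
   [alpha - beta] is nonzero. *)
have neq_ab : alpha != beta.
  apply: contraNneq (not_root 1%N isT) => ->.
  by rewrite divff // unity_rootE expr1n.
move=> n _; exact: (rmorph_lucas_seq (f := iota \o @tofrac R) n neq_ab abp abq).
Qed.
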